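(* For every prime $p\neq 3$, one has $\nu(p)=\nu(2p)=1$.
   Context: Let $F(x,y,z)=x^3+y^3+z^3-3xyz$. For a positive integer $n$, $\nu(n)$ denotes the number of triples of integers $(x,y,z)$ with $0\leq x\leq y\leq z$ and $z\geq x+1$ such that $F(x,y,z)=n$. *)

(* Defs.v *)
From mathcomp Require Import all_boot all_order all_algebra finmap.
From mathcomp Require Import classical_sets functions cardinality.
From mathcomp Require Import zify ring lra.

Set Implicit Arguments.
Unset Strict Implicit.
Unset Printing Implicit Defensive.

Import Order.TTheory GRing.Theory Num.Theory.

Local Open Scope ring_scope.
Local Open Scope classical_set_scope.

Definition F (x y z : int) : int :=
  x ^+ 3 + y ^+ 3 + z ^+ 3 - 3 * x * y * z.

Definition nu_triples (n : nat) : set (int * int * int) :=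
  [set t | let: (x, y, z) := t in
     [/\ 0 <= x, x <= y, y <= z, x + 1 <= z & F x y z = n%:Z]].

(* [fset_set] sends an infinite set to the empty one; [finite_nu_triples] below
   shows that this default is never used. *)
Definition nu (n : nat) : nat := #|` fset_set (nu_triples n)|%fset.

Lemma finite_nu_triples (n : nat) : finite_set (nu_triples n).
Proof.
pose f (t : 'I_n.+1 * 'I_n.+1 * 'I_n.+1) : int * int * int :=
  ((t.1.1 : nat)%:Z, (t.1.2 : nat)%:Z, (t.2 : nat)%:Z).
apply: (@sub_finite_set _ _ (f @` setT)); last first.
  exact/finite_image/finite_finset.
move=> [[x y] z] [x0 xy yz xz]; rewrite /F => Fn.
have zn : z <= n%:Z.
  have {}Fn : n%:Z = (x + y + z) * ((y - x) ^+ 2 + (y - x) * (z - y) + (z - y) ^+ 2).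
    by rewrite -Fn; ring.
  have q1 : 1 <= (y - x) ^+ 2 + (y - x) * (z - y) + (z - y) ^+ 2 by nia.
  have s0 : z <= x + y + z by lia.
  rewrite Fn; nia.
have bnd (a : int) : 0 <= a -> a <= z -> exists i : 'I_n.+1, (i : nat)%:Z = a.
  move=> a0 az; have lt : (`|a| < n.+1)%N by lia.
  by exists (Ordinal lt) => /=; lia.
have [i iE] := bnd x x0 ltac:(lia).
have [j jE] := bnd y ltac:(lia) ltac:(lia).
have [k kE] := bnd z ltac:(lia) ltac:(lia).
by exists (i, j, k) => //; rewrite /f /= iE jE kE.
Qed.

(* Main.v *)
Require Import Defs.
From mathcomp Require Import all_boot.
From mathcomp Require Import all_order all_algebra finmap.
From mathcomp Require Import classical_sets cardinality zify ring.

(** With [u = y - x] and [v = z - y], [F x y z] factors as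
    [(3x + 2u + v) * (u^2 + uv + v^2)].  When the product is [p] or [2p], either
    [p] divides the linear factor, and then the form, which is never [2], equals
    [1]; or [p] divides the form, and then the linear factor is at most [2],
    which leaves finitely many triples.  Hence [u + v = 1], and then [F x y z]
    is just [x + y + z], so the triple is the balanced splitting of [n] into
    three parts. *)

Lemma F_factor (x u v : nat) :
  F (Posz x) (Posz (x + u)) (Posz (x + u + v)) =
  Posz ((3 * x + 2 * u + v) * (u ^ 2 + u * v + v ^ 2)).
Proof.
by rewrite /F !(PoszD, PoszM); ring.
Qed.

(** The form is at least 3(u + v)^2 / 4, hence at least 3 once [u + v >= 2]. *)
Lemma form_le2 (u v : nat) : 0 < u + v -> u ^ 2 + u * v + v ^ 2 <= 2 -> u + v = 1.
Proof.
move=> uv_gt0; case: u uv_gt0 => [|[|u]]; case: v => [|[|v]] => *; nia.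
Qed.

Lemma factor_eq_small_mul_prime (p m x u v : nat) :
    prime p -> 0 < m <= 2 -> 0 < u + v ->
    (3 * x + 2 * u + v) * (u ^ 2 + u * v + v ^ 2) = m * p ->
  u + v = 1.
Proof.
move=> p_pr m12 uv_gt0 sq_mp; have p_gt1 := prime_gt1 p_pr.
have: p %| (3 * x + 2 * u + v) * (u ^ 2 + u * v + v ^ 2).
  by rewrite sq_mp dvdn_mull.
rewrite Euclid_dvdM // => /orP[] /dvdnP[k kE].
  apply: form_le2 => //.
  have: k * (u ^ 2 + u * v + v ^ 2) = m.
    apply/eqP; rewrite -(eqn_pmul2r (ltnW p_gt1)) -sq_mp kE.
    by rewrite mulnAC.
  by case: k {kE} => [|k]; nia.
have: (3 * x + 2 * u + v) * k = m.
  by apply/eqP; rewrite -(eqn_pmul2r (ltnW p_gt1)) -sq_mp kE mulnA.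
case: k kE => [|k] kE skm; first by nia.
have s_le2 : 3 * x + 2 * u + v <= 2 by nia.
(* A nonzero [u] forces [u = 1] and [v = 0]. *)
have [u0|u_neq0] := eqVneq u 0; last by lia.
have [v1|v2] : v = 1 \/ v = 2 by lia.
  by lia.
(* The triple [(0, 0, 2)], where [F] is [8]: excluded since [4] is not prime. *)
have p4 : p = 4 by move: sq_mp skm; rewrite u0 v2; nia.
by move: p_pr; rewrite p4.
Qed.

(** When [u + v = 1], the form is 1 and the linear factor is 3x + 1 or 3x + 2, so a multiple of 3
    would have no triple. *)
Lemma nu_eq1 (n : nat) :
    ~~ (3 %| n) ->
    (forall x u v : nat, 0 < u + v ->
       (3 * x + 2 * u + v) * (u ^ 2 + u * v + v ^ 2) = n -> u + v = 1) ->
  nu n = 1.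
Proof.
move=> n3 uvE; rewrite /nu.
suff -> : nu_triples n =
    [set (Posz (n %/ 3), Posz (n.+1 %/ 3), Posz (n.+2 %/ 3))]%classic.
  by rewrite fset_set1 cardfs1.
apply/seteqP; split=> [[[x y] z] [x0 xy yz xz Fn]|_ ->] /=.
- have [a xE] : exists a : nat, x = Posz a by exists (absz x); lia.
  have [u yE] : exists u : nat, y = Posz (a + u) by exists (absz (y - x)%R); lia.
  have [v zE] : exists v : nat, z = Posz (a + u + v) by exists (absz (z - y)%R); lia.
  subst x y z; move: Fn; rewrite F_factor => -[sq_n].
  have uv1 : u + v = 1 by apply: uvE sq_n; lia.
  have q1 : u ^ 2 + u * v + v ^ 2 = 1 by nia.
  move: sq_n; rewrite q1 muln1 => sn.
  by congr (Posz _, Posz _, Posz _); lia.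
- split; [lia..|].
  (* Here [u] is 1 if n is 2 mod 3 and 0 if n is 1 mod 3; with [v = 1 - u] the quotients take the
     shape [F_factor] expects. *)
  have [[a u] /= [-> -> -> u1 ->]] : exists au : nat * nat,
      [/\ n %/ 3 = au.1, n.+1 %/ 3 = au.1 + au.2,
          n.+2 %/ 3 = au.1 + au.2 + (1 - au.2), au.2 <= 1 &
          n = 3 * au.1 + 2 * au.2 + (1 - au.2)].
    by exists (n %/ 3, n.+1 %/ 3 - n %/ 3); split=> /=; lia.
  by rewrite F_factor; case: u u1 => [|[|//]] _; congr Posz; lia.
Qed.

Theorem proposition4 (p : nat) (hp : prime p) (hp3 : p <> 3) :
  nu p = 1 /\ nu (2 * p) = 1.
Proof.
have p_ndvd3 : ~~ (3 %| p) by rewrite dvdn_prime2 // eq_sym; apply/eqP.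
split; apply: nu_eq1 => [|x u v uv_gt0 sq]; rewrite ?Euclid_dvdM //.
  by apply: (@factor_eq_small_mul_prime p 1 x) => //; rewrite mul1n.
exact: (@factor_eq_small_mul_prime p 2 x).
Qed.
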